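(* Let $P_n$ be the path on $n$ vertices. Then $m(P_n)\ge n-6$. Moreover, $m(P_n)\ge n-5$ unless $n+1$ or $n+3$ is a power of two.
   Context: Let $G$ be a finite graph on $n$ vertices whose vertices are colored with two colors (red and blue) in an unknown way. A vertex is a majority vertex if its color class contains more than $n/2$ vertices. A query is an edge $uv$ of $G$; the answer tells whether $u$ and $v$ have the same color (SAME) or different colors (DIFF). Queries are adaptive (each query may depend on the previous answers), and the algorithm is deterministic. The majority problem on $G$ is to find a majority vertex or to show that none exists. $m(G)$ denotes the least number of queries needed in the worst case (over all colorings) to solve the majority problem on $G$. *)

(* Defs.v *)
From mathcomp Require Import all_boot.
From mathcomp Require Import boolp.
Set Implicit Arguments.
Unset Strict Implicit.
Unset Printing Implicit Defensive.

Record sgraph := SGraph {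
  vertex :> finType;
  edge : rel vertex;
  edge_sym : symmetric edge;
  edge_irr : irreflexive edge
}.
Arguments edge : clear implicits.

Definition connected (G : sgraph) := forall u v : G, connect (edge G) u v.

Definition path_edge n : rel 'I_n :=
  fun i j => (i.+1 == j :> nat) || (j.+1 == i :> nat).

Lemma path_edge_sym n : symmetric (@path_edge n).
Proof. by move=> i j; rewrite /path_edge orbC. Qed.

Lemma path_edge_irr n : irreflexive (@path_edge n).
Proof. by move=> i; rewrite /path_edge orbb gtn_eqF. Qed.

Definition path_graph n := SGraph (@path_edge_sym n) (@path_edge_irr n).

Definition coloring (V : finType) := {ffun V -> bool}.

Definition majority_vertex (V : finType) (c : coloring V) (v : V) : bool :=
  #|V| < 2 * #|[set u | c u == c v]|.

(* Deterministic adaptive algorithms as decision trees.  In [Query u v As Ad],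
   [As] is run after the answer SAME and [Ad] after the answer DIFF.
   [Output (Some v)] declares v a majority vertex, [Output None] declares that
   there is none. *)
Inductive algorithm (V : finType) :=
| Output of option V
| Query of V & V & algorithm V & algorithm V.
Arguments Output {V}.

Fixpoint queries_edges (G : sgraph) (A : algorithm G) : bool :=
  if A is Query u v As Ad
  then [&& edge G u v, queries_edges As & queries_edges Ad] else true.

Fixpoint output (V : finType) (A : algorithm V) (c : coloring V) : option V :=
  match A with
  | Output o => o
  | Query u v As Ad => if c u == c v then output As c else output Ad c
  end.

Fixpoint num_queries (V : finType) (A : algorithm V) (c : coloring V) : nat :=
  match A with
  | Output _ => 0
  | Query u v As Ad =>
      (if c u == c v then num_queries As c else num_queries Ad c).+1
  end.

Definition correct_output (V : finType) (c : coloring V) (o : option V) : bool :=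
  if o is Some v then majority_vertex c v
  else [forall v, ~~ majority_vertex c v].

Definition solves_majority (G : sgraph) (A : algorithm G) : Prop :=
  queries_edges A /\ forall c : coloring G, correct_output c (output A c).

Definition worst_case (V : finType) (A : algorithm V) : nat :=
  \max_(c : coloring V) num_queries A c.

Definition solvable_with (G : sgraph) (k : nat) : Prop :=
  exists2 A : algorithm G, solves_majority A & worst_case A <= k.

(* On a disconnected graph there may be no algorithm at all; [m G] is then 0 by
   convention.  By [solvable_connected] this does not happen for connected G. *)
Definition m (G : sgraph) : nat :=
  match pselect (exists k, `[< solvable_with G k >]) with
  | left h => ex_minn h
  | right _ => 0
  end.

Section Solvable.
Variable G : sgraph.

Let same (c : coloring G) (e : G * G) := c e.1 == c e.2.

Fixpoint query_all (es : seq (G * G)) (k : bitseq -> option G) : algorithm G :=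
  if es is e :: es' then
    Query e.1 e.2 (query_all es' (k \o cons true)) (query_all es' (k \o cons false))
  else Output (k [::]).

Lemma output_query_all es k c :
  output (query_all es k) c = k [seq same c e | e <- es].
Proof.
by elim: es k => //= e es IH k; rewrite !IH /same /=; case: (c e.1 == c e.2).
Qed.

Lemma queries_edges_query_all es k :
  all (fun e => edge G e.1 e.2) es -> queries_edges (query_all es k).
Proof. by elim: es k => //= e es IH k /andP[-> ?]; rewrite !IH. Qed.

Lemma same_connected (c c' : coloring G) : connected G ->
  (forall u v, edge G u v -> (c u == c v) = (c' u == c' v)) ->
  forall u v, (c u == c v) = (c' u == c' v).
Proof.
move=> cG ee u v; case/connectP: (cG u v) => p.
elim: p u => [|w p IH] u /=; first by move=> _ ->; rewrite !eqxx.
case/andP => /ee euw pp lp; move: euw (IH w pp lp).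
by case: (c u) (c v) (c w) (c' u) (c' v) (c' w) => [] [] [] [] [] [].
Qed.

Lemma solvable_connected : connected G -> exists k, solvable_with G k.
Proof.
move=> cG; pose es := [seq e <- enum {: G * G} | edge G e.1 e.2].
pose k s := if [pick c | [seq same c e | e <- es] == s] is Some c
            then [pick v | majority_vertex c v] else None.
exists (worst_case (query_all es k)); exists (query_all es k) => //.
split=> [|c]; first by apply: queries_edges_query_all; rewrite filter_all.
rewrite output_query_all /k; case: pickP => [c' /eqP cc'|/(_ c)]; last by rewrite eqxx.
have mE v : majority_vertex c' v = majority_vertex c v.
  rewrite /majority_vertex; congr (_ < 2 * _); apply: eq_card => u; rewrite !inE.
  apply: same_connected => // {}u {}v uv.
  have /eq_in_map /(_ (u, v)) := cc'.
  by apply; rewrite mem_filter uv mem_enum.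
case: pickP => [v|noM] /=; first by rewrite mE.
by apply/forallP => v; rewrite -mE noM.
Qed.

Lemma mP : connected G ->
  solvable_with G (m G) /\ forall k, solvable_with G k -> m G <= k.
Proof.
move=> /solvable_connected [k0 k0P]; rewrite /m; case: pselect => [h|[]]; last first.
  by exists k0; apply/asboolP.
case: ex_minnP => k /asboolP kP kmin; split=> // j jP.
by apply: kmin; apply/asboolP.
Qed.

End Solvable.

Lemma path_graph_connected n : connected (path_graph n).
Proof.
have H (u v : 'I_n) : u <= v -> connect (@path_edge n) u v.
  move: v => [v /= vn]; elim: v vn => [|v IH] vn uv.
    by rewrite (_ : u = Ordinal vn) ?connect0 //; apply: val_inj; apply/eqP; rewrite /= -leqn0.
  move: uv; rewrite leq_eqVlt => /orP[/eqP uv|uv].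
    by rewrite (_ : u = Ordinal vn) ?connect0 //; apply: val_inj.
  apply: connect_trans (IH (ltnW vn) uv) (connect1 _).
  by rewrite /path_edge /= eqxx.
move=> u v; case/orP: (leq_total u v) => /H //.
by rewrite (sym_connect_sym (@path_edge_sym n)).
Qed.

(* Main.v *)
Require Import Defs.
From mathcomp Require Import all_boot.
From mathcomp Require Import all_order all_algebra zify ring.

(** An adversary leaves at most four of the [n - 1] edges unqueried.

    At any time the queried edges cut the path into intervals, the coloring of
    each being known up to exchanging the two colors. Only the difference of the
    color classes matters: call it the weight of the interval. A query between
    two consecutive intervals merges them, and the adversary decides whether
    their weights [a] and [b] become [a + b] or [|a - b|]. The number of queries is
    at least [n] minus the final number of intervals, and an algorithm can stop
    only when one weight exceeds the sum of all others or all weights are 0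
    ([safe_position_stop]). So the adversary has to ensure that at most five
    intervals are left at that moment ([safe_decided]).

    Second phase. Consider the sign vectors for which the signed sum of the
    nonzero weights passes the test [leads], and suppose that their number is odd.
    Each query splits this number into the two numbers for its two answers
    ([sign_parity_merge]), so the adversary can keep it odd. When one weight
    dominates and more than [odd n + 1] nonzero weights are left, it is even
    ([sign_parity_dominated]). So the algorithm stops with at most one nonzero
    weight for even [n] and two for odd [n]. The count is odd if the total is
    [2 * Q + odd n], with [Q] a power of two, and the largest powers of two
    dividing the weights add up to more than [Q + odd n]: this is a computation
    with the product of the [1 + 'X^w] over ['F_2] ([sign_parity_balanced]).

    First phase. Initially all weights are 1 and the total is [n], so it has to be
    lowered to [2 * Q + odd n], which may mean halving it, without losing the
    powers of two. Mark every sixth vertex. Intervals without marks are kept at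
    weight 0 or 1; an interval with [q > 0] marks is kept at a weight between 1
    and [2 * q]. Each answer lowers the total by 0 or 2 ([choice_nat]), so the
    target is hit exactly. The weights are about a third of the number of vertices
    used for them, and this is just enough to conclude from [n <= 4 * Q + odd n - 2]
    that the powers of two still have the required sum ([growing_parity]); for
    the same reason no interval dominates earlier ([growing_undecided]).

    Zero weights could save queries, since a zero interval need not be attached
    to its neighbors. But zero intervals contain no mark, so at most two of them
    are consecutive, none can precede the first nonzero interval, and for odd [n]
    at most one can follow the last one. This leaves at most five intervals in all
    ([few_components]). *)

Set Implicit Arguments.
Unset Strict Implicit.
Unset Printing Implicit Defensive.
Import Order.TTheory GRing.Theory Num.Theory.

(** * Parity of the number of sign vectors *)

Section SignParity.
Local Open Scope ring_scope.
Implicit Types (f g : int -> bool) (ws r : seq int).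

(** Parity of the number of sign vectors [e] such that [f] holds of the sum of
    the [e_i * w_i]. *)
Fixpoint sign_parity f ws : bool :=
  if ws is w :: ws' then
    sign_parity (fun t => f (t + w)) ws' (+) sign_parity (fun t => f (t - w)) ws'
  else f 0.

Definition total_weight ws : nat := (\sum_(w <- ws) absz w)%N.

Lemma eq_sign_parity_bounded f g ws :
  (forall t, (absz t <= total_weight ws)%N -> f t = g t) ->
  sign_parity f ws = sign_parity g ws.
Proof.
elim: ws f g => /= [|w ws IH] f g fg; first by rewrite fg // /total_weight big_nil.
by congr (_ (+) _); apply: IH => t tb; apply: fg;
  rewrite /total_weight big_cons -/(total_weight ws); lia.
Qed.

Lemma eq_sign_parity f g ws : f =1 g -> sign_parity f ws = sign_parity g ws.
Proof. by move=> fg; apply: eq_sign_parity_bounded. Qed.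

(** The recursion branches on the head of the list; by commutativity of the sum
    it can branch on any entry. *)
Lemma sign_parity_mid f r1 w r2 :
  sign_parity f (r1 ++ w :: r2) =
  sign_parity (fun t => f (t + w)) (r1 ++ r2) (+) sign_parity (fun t => f (t - w)) (r1 ++ r2).
Proof.
elim: r1 f => //= a r1 IH f; rewrite !IH addbACA.
by congr (_ (+) _ (+) (_ (+) _)); apply: eq_sign_parity => t; congr f; ring.
Qed.

(** The source of the adversary's answers in the second phase: equal signs on
    [a] and [b] act as one entry [a + b], opposite signs as one entry [a - b], so
    when the left side is odd one of the two answers keeps the parity odd. *)
Lemma sign_parity_merge f r1 a b r2 :
  sign_parity f (r1 ++ a :: b :: r2) =
  sign_parity f (r1 ++ (a + b) :: r2) (+) sign_parity f (r1 ++ (a - b) :: r2).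
Proof.
rewrite !sign_parity_mid [X in _ (+) X = _]addbC addbACA.
congr (_ (+) _ (+) (_ (+) _)); apply: eq_sign_parity => t; congr f; ring.
Qed.

(** Both signs of a zero entry give the same sum. In particular an answer that
    keeps the parity odd never cancels two nonzero components. *)
Lemma sign_parity0 f r1 r2 : sign_parity f (r1 ++ 0 :: r2) = false.
Proof.
rewrite sign_parity_mid; under [X in _ (+) X]eq_sign_parity do rewrite subr0.
by under eq_sign_parity do rewrite addr0; rewrite addbb.
Qed.

Lemma sign_parity_abs f ws :
  sign_parity f ws = sign_parity f [seq (absz w)%:Z | w <- ws].
Proof.
elim: ws f => //= w ws IH f; rewrite !IH; case: (lerP 0 w) => w0.
  by rewrite (_ : (absz w)%:Z = w) //; lia.
by rewrite addbC; congr (_ (+) _); apply: eq_sign_parity => t; congr f; lia.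
Qed.

Lemma sign_parity_addb f g ws :
  sign_parity f ws (+) sign_parity g ws = sign_parity (fun t => f t (+) g t) ws.
Proof. by elim: ws f g => //= w ws IH f g; rewrite addbACA !IH. Qed.

Lemma sign_parity_false ws : sign_parity (fun=> false) ws = false.
Proof. by elim: ws => //= w ws ->. Qed.

(** Changing the sign of an even entry preserves the sum modulo 4, and changing
    the sign of an odd one shifts it by 2. So, of two entries, either one is even
    and pairs the sign vectors, or both are odd and flipping one can be undone by
    flipping the other. *)
Lemma sign_parity_mod4 e a b ws :
  sign_parity (fun t => (4 %| t + e)%Z) [:: a, b & ws] = false.
Proof.
rewrite /= !sign_parity_addb -[RHS](sign_parity_false ws).
apply: eq_sign_parity => t; lia.
Qed.
End SignParity.

(** * Odd parity from powers of two *)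

Section Leading.
Local Open Scope ring_scope.
(** The test applied to signed sums; [o] is the parity of the total. When the
    total is odd, exactly half of the sign vectors give a positive sum, so
    positivity alone carries no information, and the residue 3 modulo 4 is
    required in addition. *)
Definition leads (o : bool) (t : int) : bool := (0 < t) && (o ==> (4 %| t + 1)%Z).

(** If [d] exceeds all the rest then its sign decides whether the sum is
    positive, so what remains of the test is constant ([o = false]) or depends on
    the sum modulo 4 only ([o = true]). The parity is even as soon as one,
    respectively two, other entries are free. Hence an odd parity forbids the
    algorithm to stop while too many nonzero components are left. *)
Lemma sign_parity_dominated (o : bool) (r1 : seq int) d r2 :
  (o < size (r1 ++ r2))%N -> (total_weight (r1 ++ r2) < absz d)%N ->
  sign_parity (leads o) (r1 ++ d :: r2) = false.
Proof.
move=> so dom; rewrite sign_parity_mid.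
have key e : (total_weight (r1 ++ r2) < absz e)%N -> 0 < e ->
    sign_parity (fun t => leads o (t + e)) (r1 ++ r2) (+)
    sign_parity (fun t => leads o (t - e)) (r1 ++ r2) = false.
  move=> {}dom e0;
  rewrite (@eq_sign_parity_bounded (fun t => leads o (t - e)) (fun=> false)); last first.
    by move=> t tb; rewrite /leads; case: (ltrP 0 (t - e)) => // ?; lia.
  rewrite sign_parity_false addbF.
  rewrite (@eq_sign_parity_bounded _ (fun t => o ==> (4 %| t + (e + 1))%Z)); last first.
    by move=> t tb; rewrite /leads -addrA (_ : 0 < t + e) //; lia.
  case: o so => /=; last by case: (r1 ++ r2) => //= *; rewrite addbb.
  by case: (r1 ++ r2) => // a [|b r] // _; apply: sign_parity_mod4.
case: (ltrP 0 d) => d0; first exact: key.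
(* A negative [d] exchanges the two branches. *)
rewrite addbC -[RHS](key (- d)) ?absz_nat; try lia.
by congr (_ (+) _); apply: eq_sign_parity => t; rewrite ?opprK.
Qed.
End Leading.

Section Poly.
Local Open Scope ring_scope.
Implicit Types (P R : {poly 'F_2}) (f g : nat -> bool).

Let pchar2 : 2%N \in [pchar 'F_2]. Proof. exact: pchar_Fp. Qed.
Let ppchar2 : 2%N \in [pchar {poly 'F_2}]. Proof. by rewrite pchar_poly. Qed.

(** The value at [P] of the linear form that sends ['X^i] to [f i]. It turns the
    count of sign vectors into algebra over ['F_2]: multiplying [P] by
    [1 + 'X^w] acts on [f] as adding its shift by [w]. *)
Definition pairing P f : 'F_2 := \sum_(0 <= i < size P) P`_i * (f i)%:R.

Lemma pairing_widen P f m : (size P <= m)%N ->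
  pairing P f = \sum_(0 <= i < m) P`_i * (f i)%:R.
Proof.
move=> Pm; rewrite (@big_cat_nat _ _ _ (size P)) //= -/(pairing _ _) -[LHS]addr0.
congr (_ + _); rewrite big_nat big1 // => i /andP[Pi _].
by rewrite nth_default ?mul0r.
Qed.

Lemma natr_addb (a b : bool) : (a (+) b)%:R = a%:R + b%:R :> 'F_2.
Proof. by case: a b => [] []; apply/eqP. Qed.

Lemma pairing_addb P f g : pairing P f + pairing P g = pairing P (fun i => f i (+) g i).
Proof. by rewrite -big_split; apply: eq_bigr => i _; rewrite natr_addb mulrDr. Qed.

Lemma pairing_shift P f w :
  pairing ((1 + 'X^w) * P) f = pairing P f + pairing P (fun i => f (i + w)%N).
Proof.
have sz : (size ((1 + 'X^w) * P)%R <= w + size P)%N.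
  have s1 : (size (1 + 'X^w : {poly 'F_2})%R <= w.+1)%N.
    by apply: leq_trans (size_polyD _ _) _; rewrite size_polyXn size_poly1 geq_max leqnn.
  by apply: leq_trans (size_polyMleq _ _) _; rewrite -ltnS; lia.
rewrite (pairing_widen _ sz) (@pairing_widen P f (w + size P)) ?leq_addl //.
under eq_bigr => i _ do rewrite mulrDl mul1r coefD coefXnM mulrDl.
rewrite big_split /=; congr (_ + _).
rewrite (@big_cat_nat _ _ _ w) ?leq_addr //= big_nat big1 ?add0r; last first.
  by move=> i /andP[_ iw]; rewrite iw mul0r.
rewrite -{1}[w]add0n big_addn addKn; apply: eq_big_nat => i _.
by rewrite ltnNge leq_addl /= addnK.
Qed.

(** The coefficient of ['X^i] counts, modulo 2, the subfamilies of total [i]. *)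
Definition weight_poly (ws : seq nat) : {poly 'F_2} := \prod_(w <- ws) (1 + 'X^w).

Lemma sign_parity_pairing (f : int -> bool) (ws : seq nat) :
  (sign_parity f [seq w%:Z | w <- ws])%:R =
  pairing (weight_poly ws) (fun i => f (2 * i%:Z - (sumn ws)%:Z)).
Proof.
elim: ws f => [|w ws IH] f /=.
  by rewrite /weight_poly big_nil /pairing size_poly1 big_nat1 coef1 mul1r.
rewrite natr_addb !IH /weight_poly big_cons pairing_shift addrC.
by congr (_ + _); apply: eq_bigr => i _; congr (_ * (f _)%:R); lia.
Qed.

Lemma size_weight_poly ws : all (fun w => 0 < w)%N ws -> size (weight_poly ws) = (sumn ws).+1.
Proof.
have s1 w : (0 < w)%N -> size (1 + 'X^w : {poly 'F_2}) = w.+1.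
  by move=> w0; rewrite addrC size_polyDl size_polyXn ?size_poly1.
elim: ws => [|w ws IH] /=; first by rewrite /weight_poly big_nil size_poly1.
case/andP => w0 /IH {}IH; rewrite /weight_poly big_cons size_mul -?size_poly_gt0 ?s1 ?IH //=.
lia.
Qed.

Lemma horner_weight_poly0 ws : all (fun w => 0 < w)%N ws -> (weight_poly ws).[0] = 1.
Proof.
rewrite /weight_poly; elim: ws => [|w ws IH] /=; first by rewrite big_nil hornerE.
by case/andP => w0 /IH {}IH; rewrite big_cons hornerM IH !hornerE expr0n gtn_eqF ?addr0.
Qed.

Lemma pow2_frobenius j (x : {poly 'F_2}) : (1 + x) ^+ (2 ^ j) = 1 + x ^+ (2 ^ j).
Proof.
rewrite exprDn_pchar ?expr1n // (eq_pnat _ (pcharf_eq ppchar2)).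
by rewrite pnatX pnat_id.
Qed.

(** With [w = 2 ^ j * d] and [d] odd, [1 + 'X^w] is the [2 ^ j]-th power of
    [1 + 'X^d], which vanishes at 1. So every weight contributes its 2-part to the
    multiplicity of the root 1. *)
Lemma dvdp_weight w : (0 < w)%N -> (1 + 'X) ^+ (w`_2)%N %| (1 + 'X^w : {poly 'F_2}).
Proof.
move=> w0; rewrite -{2}(partnC 2%N w0) mulnC exprM p_part -pow2_frobenius.
apply: dvdp_exp2r.
have -> : 1 + 'X = 'X - 1%:P :> {poly 'F_2} by rewrite oppr_pchar2 // addrC.
by rewrite dvdp_XsubCl rootE !hornerE expr1n.
Qed.

Lemma dvdp_weight_poly ws : all (fun w => 0 < w)%N ws ->
  (1 + 'X) ^+ (sumn [seq (w`_2)%N | w <- ws]) %| weight_poly ws.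
Proof.
rewrite /weight_poly; elim: ws => [|w ws IH] /=; first by rewrite expr0 dvd1p.
by case/andP => w0 /IH; rewrite big_cons exprD; apply: dvdp_mul; apply: dvdp_weight.
Qed.

(** The parity is odd when the total is [2 * Q + o], with [Q] a power of two, and
    the 2-parts of the weights add up to more than [Q + o]. The 2-parts provide a
    factor [(1 + 'X) ^+ (o.+1 + Q)], which equals
    [(1 + 'X^(o.+1)) * (1 + 'X^Q)] in characteristic 2. The first factor turns the
    test [leads o], read as a predicate on the total of the positive entries, into
    the indicator of [Q]: what is left is the coefficient of ['X^Q] in
    [(1 + 'X^Q) * R]. Since [R] has degree [Q - 1] and constant term 1, that
    coefficient is 1. *)
Lemma sign_parity_balanced (o : bool) k (ws : seq int) :
  all (fun w => w != 0) ws -> total_weight ws = (2 * 2 ^ k + o)%N ->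
  (2 ^ k + o < \sum_(w <- ws) ((absz w)`_2)%N)%N -> sign_parity (leads o) ws.
Proof.
set Q := (2 ^ k)%N => ws0 tot good; have Q0 : (0 < Q)%N by rewrite expn_gt0.
rewrite sign_parity_abs.
rewrite (map_comp Posz absz); set ns := map absz ws.
have ns0 : all (fun w => 0 < w)%N ns.
  by rewrite all_map; apply: sub_all ws0 => w /=; rewrite absz_gt0.
have sns : sumn ns = (2 * Q + o)%N by rewrite sumnE big_map -tot.
have [R PR] : exists R, weight_poly ns = (1 + 'X^(o.+1)) * ((1 + 'X^Q) * R).
  have /dvdpP[R ->] : (1 + 'X) ^+ (o.+1 + Q) %| weight_poly ns.
    apply: dvdp_trans (dvdp_weight_poly ns0); apply: dvdp_exp2l.
    by rewrite sumnE !big_map; lia.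
  exists R; rewrite exprD pow2_frobenius mulrC -mulrA; congr (_ * _).
  by case: (o) => //; apply: (pow2_frobenius 1).
clearbody Q.
have Qneq : (1 + 'X^Q : {poly 'F_2}) != 0.
  by rewrite -size_poly_gt0 addrC size_polyDl size_polyXn ?size_poly1.
have oneq : (1 + 'X^(o.+1) : {poly 'F_2}) != 0.
  by rewrite -size_poly_gt0 addrC size_polyDl size_polyXn ?size_poly1.
have P0 := horner_weight_poly0 ns0.
have R0 : R.[0] = 1.
  by move: P0; rewrite PR !hornerM !hornerE !expr0n /= gtn_eqF // !addr0 !mul1r.
have Rneq : R != 0 by apply: contra_eq_neq R0 => ->; rewrite hornerE eq_sym oner_eq0.
have szR : size R = Q.
  have := size_weight_poly ns0; rewrite PR !size_mul ?mulf_neq0 // sns.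
  rewrite ![1 + _]addrC !size_polyDl ?size_polyXn ?size_poly1 //.
  move: Rneq; rewrite -size_poly_gt0; case: (size R) => // r _; clear; case: o => /=; lia.
have : (sign_parity (leads o) [seq w%:Z | w <- ns])%:R = 1 :> 'F_2.
  rewrite sign_parity_pairing PR pairing_shift pairing_addb sns.
  set P' := _ * R; have szP' : (Q < size P')%N.
    by rewrite size_mul // addrC size_polyDl ?size_polyXn ?size_poly1 // szR; lia.
  transitivity (P'`_Q).
    rewrite /pairing (eq_bigr (fun i => if i == Q then P'`_Q else 0)).
      by rewrite -big_mkcond big_nat1_eq szP'.
    move=> i _.
    have -> : leads o (2 * i%:Z - (2 * Q + o)%:Z) (+)
              leads o (2 * (i + o.+1)%:Z - (2 * Q + o)%:Z) = (i == Q).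
      rewrite /leads; case: (o) => /=; lia.
    by case: eqP => [->|_]; rewrite ?mulr1 ?mulr0.
  rewrite /P' mulrDl mul1r coefD coefXnM ltnn subnn nth_default ?szR // add0r.
  by rewrite -horner_coef0 R0.
by case: sign_parity.
Qed.
End Poly.

(** * The merging game *)

Lemma dist_or_sum (a e : int) :
  (absz (a + e)%R = absz a + absz e /\
    absz (a - e)%R = (absz a - absz e) + (absz e - absz a)) \/
  (absz (a - e)%R = absz a + absz e /\
    absz (a + e)%R = (absz a - absz e) + (absz e - absz a)).
Proof. by case: (lerP 0 a) (lerP 0 e) => ? [] ?; [left|right|right|left]; split; lia. Qed.

(** One of the two possible weights of a union respects the bound
    [maxn 1 (2 * marks)] again. Two marked components are added, which also keeps
    the result nonzero; otherwise the difference is taken, except that a marked 1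
    and another 1 are added, since the union must not vanish. A difference is taken only
    when the smaller weight is at most 1, so the total drops by at most 2. *)
Lemma choice_nat (A E p q : nat) :
  A <= maxn 1 (2 * p) -> E <= maxn 1 (2 * q) ->
  (A = 0 -> p = 0) -> (E = 0 -> q = 0) ->
  exists2 C, C = A + E \/ C = (A - E) + (E - A) &
    [/\ C <= maxn 1 (2 * (p + q)), (C = 0 -> p = 0 /\ q = 0) &
        C <= A + E <= C + 2].
Proof.
move=> Ap Eq A0 E0.
have [pq|pq] := boolP ((0 < p) && (0 < q) || ((0 < p) || (0 < q)) && (A == 1) && (E == 1)).
  exists (A + E); first by left.
  by case: p q Ap Eq A0 E0 pq => [|p] [|q] Ap Eq A0 E0 pq; split; lia.
exists (A - E + (E - A)); first by right.
by case: p q Ap Eq A0 E0 pq => [|p] [|q] Ap Eq A0 E0 pq; split; lia.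
Qed.

Section Pattern.
Variables (n r : nat).
Hypothesis r6 : r < 6.

(** Every sixth vertex is marked. A component that contains a mark is never
    allowed to cancel, so cancelled components lie in the intervals of five
    vertices between consecutive marks. *)
Definition pattern : seq bool := [seq i %% 6 == r | i <- iota 0 n].

Lemma count_iota_mod6 p q :
  count (fun i => i %% 6 == r) (iota p q) + (p + 5 - r) %/ 6 = (p + q + 5 - r) %/ 6.
Proof. by elim: q p => [|q IH] p /=; [lia|move: (IH p.+1); case: eqP; lia]. Qed.

(** Marks are counted by a difference of floor divisions, so that the bounds on
    intervals below reduce to linear arithmetic. *)
Lemma count_pattern l1 l l2 : pattern = l1 ++ l ++ l2 ->
  count id l + (size l1 + 5 - r) %/ 6 = (size l1 + size l + 5 - r) %/ 6 /\
  size l1 + size l + size l2 = n.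
Proof.
move=> E; have sz := congr1 size E; rewrite size_map size_iota !size_cat in sz.
split; last lia.
have -> : l = [seq i %% 6 == r | i <- iota (size l1) (size l)].
  have := congr1 (take (size l) \o drop (size l1)) E.
  rewrite /= drop_size_cat // take_size_cat // => <-.
  rewrite -map_drop -map_take drop_iota take_iota add0n; congr map; congr iota.
  by rewrite size_map size_iota; lia.
by rewrite count_map size_map size_iota count_iota_mod6.
Qed.
End Pattern.

Section Game.
Variables (n k : nat).
Let o := odd n.
Let Q := 2 ^ k.
Let r : nat := n %% 6 == 5.
Hypothesis nQ : 2 * Q + o <= n.
Hypothesis Qn : n + 2 <= 4 * Q + o.

(** The vertices of an interval enter only through their marks; the integer is
    the difference of its color classes, whose sign is immaterial. *)
Definition component : Type := seq bool * int.
Implicit Types (x y : component) (s : seq component).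

Definition marks x := count id x.1.

(** What holds in both phases. An unmarked component may have weight 0, and the
    parity condition then forces it to have at least two vertices. *)
Definition sound x :=
  [&& 0 < size x.1, odd (absz x.2) == odd (size x.1), absz x.2 <= size x.1
    & (x.2 == 0%R) ==> (marks x == 0)].

(** The growth bound of the first phase: marks are 6 apart, so the weight of a
    marked component is at most about a third of its size. *)
Definition light x := absz x.2 <= maxn 1 (2 * marks x).

Definition mass s := \sum_(x <- s) absz x.2.

Definition carrier s := flatten [seq x.1 | x <- s].

Definition valid s := carrier s = pattern n r /\ all sound s.

Definition weights s := [seq w <- [seq x.2 | x <- s] | w != 0%R].

(** First phase: weights grow slowly, and the total has not yet dropped below
    [2 * Q + o]. *)
Definition growing s := all light s && (2 * Q + o <= mass s).

(** Second phase: few nonzero components, or an odd count of sign vectors. *)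
Definition critical s :=
  (size (weights s) <= o.+1) || sign_parity (leads o) (weights s).

Definition join (b : bool) x y : component :=
  (x.1 ++ y.1, if b then (x.2 + y.2)%R else (x.2 - y.2)%R).

(** The only two situations in which an algorithm can stop. *)
Definition decided s :=
  all (fun x => x.2 == 0%R) s \/
  exists s1 x s2, s = s1 ++ x :: s2 /\ mass (s1 ++ s2) < absz x.2.

Let r1 : r <= 1. Proof. exact: leq_b1. Qed.
Let r6 : r < 6. Proof. exact: (leq_ltn_trans r1). Qed.

Lemma carrier_cat s1 s2 : carrier (s1 ++ s2) = carrier s1 ++ carrier s2.
Proof. by rewrite /carrier map_cat flatten_cat. Qed.

Lemma carrier_cons x s : carrier (x :: s) = x.1 ++ carrier s.
Proof. by []. Qed.

Lemma carrier_merge b s1 x y s2 :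
  carrier (s1 ++ join b x y :: s2) = carrier (s1 ++ x :: y :: s2).
Proof. by rewrite !carrier_cat !carrier_cons /= -catA. Qed.

Lemma mass_cat s1 s2 : mass (s1 ++ s2) = mass s1 + mass s2.
Proof. exact: big_cat. Qed.

Lemma mass_cons x s : mass (x :: s) = absz x.2 + mass s.
Proof. exact: big_cons. Qed.

Lemma mass_nil : mass [::] = 0.
Proof. exact: big_nil. Qed.

Lemma weights_cat s1 s2 : weights (s1 ++ s2) = weights s1 ++ weights s2.
Proof. by rewrite /weights map_cat filter_cat. Qed.

Lemma weights_cons x s :
  weights (x :: s) = if x.2 != 0%R then x.2 :: weights s else weights s.
Proof. by []. Qed.

Lemma total_weight_weights s : total_weight (weights s) = mass s.
Proof.
elim: s => [|x s IH]; first by rewrite /total_weight /mass !big_nil.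
rewrite weights_cons mass_cons -IH; case: eqP => [->|_] //=.
by rewrite /total_weight big_cons.
Qed.

Lemma sound_merge b x y : sound x -> sound y ->
  ((join b x y).2 = 0%R -> marks x = 0 /\ marks y = 0) -> sound (join b x y).
Proof.
case: x y => [c a] [d e] /and4P[/= c0 /eqP ca a_c _] /and4P[/= d0 /eqP de e_d _] z0.
have par2 : odd (absz (join b (c, a) (d, e)).2) = odd (absz a) (+) odd (absz e).
  by clear; case: b => /=; lia.
apply/and4P; split.
- by rewrite size_cat addn_gt0 c0.
- by rewrite par2 /= size_cat oddD ca de.
- by case: b {z0 par2} => /=; rewrite size_cat; lia.
by apply/implyP => /eqP /z0 []; rewrite /marks /= count_cat => -> ->.
Qed.

Lemma mass_odd s : valid s -> odd (mass s) = o.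
Proof.
case=> car /allP snd.
have -> : o = odd (size (carrier s)) by rewrite car size_map size_iota.
elim: s snd {car} => [|x s IH] snd; first by rewrite mass_nil.
rewrite mass_cons carrier_cons size_cat !oddD IH; last first.
  by move=> y ys; apply: snd; rewrite inE ys orbT.
by have /and4P[_ /eqP-> _ _] := snd x (mem_head _ _).
Qed.

Lemma valid_mid s1 x s2 : valid (s1 ++ x :: s2) -> sound x.
Proof. by case=> _; rewrite all_cat /= => /and3P[]. Qed.

Lemma marks_size s1 x s2 : valid (s1 ++ x :: s2) -> 6 * marks x <= size x.1 + 5.
Proof.
case; rewrite carrier_cat carrier_cons => /esym /(count_pattern r6)[+ _] _.
by rewrite -/(marks x); lia.
Qed.

Lemma part2_bound w : 0 < w -> (~~ odd w).+1 <= w`_2.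
Proof.
move=> w0; case: (boolP (odd w)) => [_|wev]; first exact: part_gt0.
rewrite p_part -{1}(expn1 2) leq_exp2l // logn_gt0 mem_primes w0 /=.
by rewrite dvdn2.
Qed.

(** The local inequality behind the end of the first phase. A component with
    [q] marks has at least [6 * q - 5] vertices and weight at most [2 * q]. This
    leaves a deficit of at most 4 when the weight is even and of at most 2 when it
    is odd, which twice the 2-part of the weight covers. *)
Lemma weight_bound x : sound x -> light x -> 6 * marks x <= size x.1 + 5 ->
  3 * absz x.2 <= (if x.2 != 0%R then 2 * (absz x.2)`_2 else 0) + size x.1.
Proof.
case: x => c a /and4P[/= c0 /eqP ca a_c _]; rewrite /light /marks /=.
case: eqP => [->|a0] //=.
have /part2_bound : 0 < absz a by lia.
move: (absz a) ca a_c {a0} => w; case: (boolP (odd w)) => /=; lia.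
Qed.

(** Summing [weight_bound] gives [3 * (2 * Q + o) <= 2 * g + n] for the sum [g] of
    the 2-parts. As [n <= 4 * Q + o - 2], this yields [g > Q + o], which is what
    [sign_parity_balanced] asks for. *)
Lemma growing_parity s : valid s -> all light s -> mass s = 2 * Q + o ->
  sign_parity (leads o) (weights s).
Proof.
move=> vs ls ms; apply: (@sign_parity_balanced _ k).
- exact: filter_all.
- by rewrite total_weight_weights.
suff : 3 * mass s <= 2 * (\sum_(w <- weights s) (absz w)`_2) + size (carrier s).
  rewrite (proj1 vs) size_map size_iota ms -/Q -/o; move: Qn.
  by move: (\sum_(w <- _) _) Q (nat_of_bool o) => S q b; clear; lia.
have key s1 s2 : s = s1 ++ s2 ->
    3 * mass s2 <= 2 * (\sum_(w <- weights s2) (absz w)`_2) + size (carrier s2).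
  elim: s2 s1 => [|x s2 IH] s1 E; first by rewrite mass_nil.
  have {}IH := IH (rcons s1 x); rewrite cat_rcons in IH; have {}IH := IH E.
  rewrite mass_cons weights_cons carrier_cons size_cat.
  rewrite E in vs ls; have mb := marks_size vs.
  have lx : light x by move: ls; rewrite all_cat /= => /and3P[].
  have := weight_bound (valid_mid vs) lx mb.
  by case: ifP => _; rewrite ?big_cons; lia.
exact: (key [::]).
Qed.

Lemma growing_merge x y : sound x -> sound y -> light x -> light y ->
  exists b, [/\ sound (join b x y), light (join b x y) &
    absz (join b x y).2 <= absz x.2 + absz y.2 <= absz (join b x y).2 + 2].
Proof.
move=> sx sy lx ly.
have marks0 z : sound z -> absz z.2 = 0 -> marks z = 0.
  by case/and4P=> _ _ _ /implyP h /eqP; rewrite absz_eq0 => /h /eqP.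
have [C defC [lC C0 Cb]] := choice_nat lx ly (marks0 x sx) (marks0 y sy).
have [b bC] : exists b, absz (join b x y).2 = C.
  by case: (dist_or_sum x.2 y.2) defC => [] [E1 E2] [] ->;
    [exists true|exists false|exists false|exists true].
exists b; split; last by rewrite bC.
- by apply: sound_merge => // z0; apply: C0; rewrite -bC z0.
by rewrite /light bC /marks count_cat.
Qed.

Lemma valid_merge b s1 x y s2 : valid (s1 ++ x :: y :: s2) ->
  sound (join b x y) -> valid (s1 ++ join b x y :: s2).
Proof.
case=> car snd sxy; split; first by rewrite carrier_merge.
by move: snd; rewrite !all_cat /= sxy => /and4P[-> _ _ ->].
Qed.

(** The total keeps its parity and drops by at most 2 per answer, so it cannot
    jump over [2 * Q + o]. *)
Lemma growing_step s1 x y s2 : let s := s1 ++ x :: y :: s2 in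
  valid s -> growing s -> 2 * Q + o < mass s ->
  exists b, valid (s1 ++ join b x y :: s2) /\ growing (s1 ++ join b x y :: s2).
Proof.
move=> s vs /andP[ls _] ms.
have [sx sy] : sound x /\ sound y.
  by case: vs => _; rewrite all_cat /= => /and4P[].
move: ls; rewrite all_cat /= => /and4P[l1 lx ly l2].
have [b [sb lb mb]] := growing_merge sx sy lx ly.
have vs' := valid_merge vs sb.
exists b; split=> //; rewrite /growing all_cat /= l1 lb l2 /=.
have := mass_odd vs'; have := mass_odd vs; move: ms; rewrite /s.
rewrite !mass_cat !mass_cons; move: mb (mass s1) (mass s2) => mb M1 M2.
move: (absz _) (absz _) (absz _) mb => A B C; move: Q (o) => q b'; clear; case: b' => /=; lia.
Qed.

(** Answers that involve a zero component do not change the nonzero weights. For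
    two nonzero components [sign_parity_merge] offers an answer that keeps the
    parity odd, and the union is then nonzero by [sign_parity0]. *)
Lemma critical_step s1 x y s2 : let s := s1 ++ x :: y :: s2 in
  valid s -> critical s ->
  exists b, valid (s1 ++ join b x y :: s2) /\ critical (s1 ++ join b x y :: s2).
Proof.
move=> s vs cs.
have [sx sy] : sound x /\ sound y.
  by case: vs => _; rewrite all_cat /= => /and4P[].
have marks0 z : sound z -> (z.2 = 0)%R -> marks z = 0.
  by case/and4P=> _ _ _ /implyP h /eqP /h /eqP.
have [xy0|xyn0] := boolP ((x.2 == 0%R) || (y.2 == 0%R)).
  have sxy : sound (join true x y).
    apply: sound_merge => //= z0; split; apply: marks0 => //;
    by case/orP: xy0 => /eqP e; move: z0; rewrite e; lia.
  exists true; split; first exact: valid_merge.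
  suff E : weights (s1 ++ join true x y :: s2) = weights s by rewrite /critical E.
  rewrite /s !weights_cat !weights_cons /=; congr (_ ++ _).
  by case/orP: xy0 => /eqP ->; rewrite ?add0r ?addr0 eqxx /=.
rewrite negb_or in xyn0; case/andP: xyn0 => xn0 yn0.
have step b : (join b x y).2 != 0%R ->
    (size (weights s1 ++ (join b x y).2 :: weights s2) <= o.+1) ||
      sign_parity (leads o) (weights s1 ++ (join b x y).2 :: weights s2) ->
    exists b, valid (s1 ++ join b x y :: s2) /\ critical (s1 ++ join b x y :: s2).
  move=> bn0 crit; exists b; split.
    by apply: valid_merge => //; apply: sound_merge => // z0; rewrite z0 in bn0.
  by rewrite /critical weights_cat weights_cons bn0.
move: cs; rewrite /critical /s weights_cat !weights_cons xn0 yn0.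
case/orP => [small|].
  have [b bn0] : exists b, (join b x y).2 != 0%R.
    have [e|] := eqVneq (x.2 + y.2)%R 0%R; last by exists true.
    by exists false => /=; move: xn0; lia.
  by apply: (step b bn0); apply/orP; left; move: small; rewrite !size_cat /=; lia.
rewrite sign_parity_merge.
have nz b : sign_parity (leads o) (weights s1 ++ (join b x y).2 :: weights s2) ->
    exists b, valid (s1 ++ join b x y :: s2) /\ critical (s1 ++ join b x y :: s2).
  move=> p; apply: (step b); last by rewrite p orbT.
  by apply: contraTneq p => ->; rewrite sign_parity0.
by case: (boolP (sign_parity _ _)) => [/(nz true)|_ /(nz false)].
Qed.

Lemma zero_run s1 z s2 : valid (s1 ++ z ++ s2) -> weights z = [::] ->
  2 * size z <= size (carrier z) /\ count id (carrier z) = 0.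
Proof.
case=> _; rewrite !all_cat => /and3P[_ snd _].
elim: z snd => //= x z IH /andP[sx /IH {}IH].
rewrite weights_cons; case: eqP => //= x0 /IH [IH1 IH2].
rewrite carrier_cons size_cat count_cat IH2; move: sx; rewrite /sound x0 /=.
case/and3P => sx0 /eqP od /eqP mx; rewrite -/(marks x) mx; split=> //.
by move: sx0 od IH1; case: (size x.1) => [|[|c]] //= _ _; lia.
Qed.

(** A run of zero components contains no mark, so it spans at most five vertices;
    at two or more vertices each, there are at most two of them. Before the first
    mark there is room for at most one vertex, and after the last one, when [n] is
    odd, for at most three. The choice of the residue of the marks ensures this. *)
Lemma zero_run_size s1 z s2 : valid (s1 ++ z ++ s2) -> weights z = [::] ->
  [/\ size z <= 2, s1 = [::] -> z = [::] & o -> s2 = [::] -> size z <= 1].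
Proof.
move=> vs wz; have [sz cz] := zero_run vs wz.
case: vs => + _; rewrite !carrier_cat => /esym /(count_pattern r6); rewrite cz add0n.
rewrite /r /o; case=> cnt tot; split; first lia.
  by move=> s10; apply: size0nil; rewrite s10 /= in cnt; move: cnt; case: eqP => /= _; lia.
by move=> on s20; rewrite s20 /= in tot; move: cnt; case: eqP => /= n6; lia.
Qed.

Lemma split_nonzero s : weights s != [::] ->
  exists s1 x s2, [/\ s = s1 ++ x :: s2, weights s1 = [::] &
    size (weights s) = (size (weights s2)).+1].
Proof.
elim: s => //= x s IH; rewrite weights_cons; case: ifP => xn0.
  by move=> _; exists [::], x, s.
case/IH => s1 [y [s2 [-> w1 ->]]]; exists (x :: s1), y, s2.
by rewrite weights_cons xn0.
Qed.

(** With two nonzero components (possible for odd [n] only) there are at most two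
    zero components between them, none on their left and one on their right. *)
Lemma few_components s : valid s -> size (weights s) <= o.+1 -> size s <= 5.
Proof.
move=> vs few; have [w0|] := eqVneq (weights s) [::].
  have vs' : valid ([::] ++ s ++ [::]) by rewrite cats0.
  by have [_ -> //] := zero_run_size vs' w0.
case/split_nonzero => s1 [x [s2 [Es w1 sz]]]; rewrite {}Es in vs few sz *.
have [_ s10 _] := @zero_run_size [::] _ _ vs w1.
rewrite {}s10 // in vs few sz *.
have [w2|] := eqVneq (weights s2) [::].
  have vs' : valid ([:: x] ++ s2 ++ [::]) by rewrite cats0.
  by have [? _ _] := zero_run_size vs' w2; rewrite /=; lia.
case/split_nonzero => s3 [y [s4 [Es w3 sz']]]; rewrite {}Es in vs few sz sz' *.
have [on w4] : o /\ weights s4 = [::].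
  by move: few; rewrite sz sz'; case: o => //; case: (weights s4).
have [z3 _ _] := @zero_run_size [:: x] _ _ vs w3.
have vs' : valid ((x :: s3 ++ [:: y]) ++ s4 ++ [::]).
  by rewrite cats0 /= -catA.
have [_ _ z4] := zero_run_size vs' w4.
by have := z4 on erefl; rewrite /= size_cat /=; lia.
Qed.

Lemma sign_parity_decided s : sign_parity (leads o) (weights s) -> decided s ->
  size (weights s) <= o.+1.
Proof.
move=> ps [z|[s1 [x [s2 [E dom]]]]].
  have -> : weights s = [::]; last by [].
  by elim: s z {ps} => //= x s IH /andP[/eqP x0 /IH]; rewrite weights_cons x0.
have xn0 : x.2 != 0%R by rewrite -absz_gt0; lia.
move: ps; rewrite E weights_cat weights_cons xn0 => ps.
rewrite size_cat /= addnS -size_cat ltnS leqNgt; apply: contraL ps => big.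
by rewrite sign_parity_dominated // -weights_cat total_weight_weights.
Qed.

Lemma marked_size x : sound x -> light x -> 6 * marks x <= size x.1 + 5 ->
  3 * absz x.2 <= size x.1 + 5.
Proof.
case/and4P=> x0 _ _ _; rewrite /light; move: (absz _) (size _) (marks x) x0.
by move=> w c q; case: q => [|q]; lia.
Qed.

Lemma mass_size s : all sound s -> mass s <= size (carrier s).
Proof.
elim: s => [|x s IH] /=; first by rewrite mass_nil.
case/andP => /and4P[_ _ xs _] /IH; rewrite mass_cons carrier_cons size_cat; exact: leq_add.
Qed.

(** A dominating component would need more than half of the total [mass s], hence
    roughly three times as many vertices, and the others at least one vertex per
    unit of weight: together more than [n <= 4 * Q + o - 2] vertices. *)
Lemma growing_undecided s : valid s -> growing s -> 2 * Q + o < mass s ->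
  decided s -> False.
Proof.
move=> vs /andP[ls _] ms [z|[s1 [x [s2 [E dom]]]]].
  suff m0 : mass s = 0 by rewrite m0 in ms.
  by rewrite /mass big_seq big1 // => x /(allP z)/eqP ->.
have od := mass_odd vs; have [car snd] := vs.
have ncar : size (carrier s) = n by rewrite car size_map size_iota.
rewrite {}E in vs ls ms od car snd ncar.
have b6 := marks_size vs.
move: ls snd; rewrite !all_cat /= => /and3P[_ lx _] /and3P[a1 sx a2].
have b3 := marked_size sx lx b6.
have := mass_size a1; have := mass_size a2.
move: ncar ms od dom; rewrite carrier_cat carrier_cons !size_cat !mass_cat mass_cons.
move: b3 Qn; move: (absz _) (mass _) (mass _) (size x.1) (size _) (size _) Q => A M1 M2 c c1 c2 q.
by case: o => /=; lia.
Qed.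

Definition safe s := valid s /\ (growing s \/ critical s).

(** A state of the first phase whose total has reached [2 * Q + o] belongs to the
    second phase too. *)
Lemma safe_cases s : safe s ->
  valid s /\ ((growing s /\ 2 * Q + o < mass s) \/ critical s).
Proof.
case=> vs gc; split=> //; case: gc => [gs|]; last by right.
case/andP: (gs) => ls; rewrite leq_eqVlt => /orP[/eqP ms|ms]; last by left.
by right; rewrite /critical growing_parity ?orbT.
Qed.

Lemma safe_step s1 x y s2 : safe (s1 ++ x :: y :: s2) ->
  exists b, safe (s1 ++ join b x y :: s2).
Proof.
case/safe_cases => vs [[gs ms]|cs].
  by have [b [vb gb]] := growing_step vs gs ms; exists b; split; [|left].
by have [b [vb cb]] := critical_step vs cs; exists b; split; [|right].
Qed.

Lemma safe_decided s : safe s -> decided s -> size s <= 5.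
Proof.
case/safe_cases => vs [[gs ms] /(growing_undecided vs gs ms) //|cs ds].
apply: few_components => //; case/orP: cs => // ps; exact: sign_parity_decided.
Qed.

Lemma safe_start : safe [seq ([:: i %% 6 == r], 1%R) | i <- iota 0 n].
Proof.
split.
  split; last by rewrite all_map; apply/allP => i _; rewrite /sound /=.
  rewrite /carrier -map_comp /pattern; elim: (iota 0 n) => //= i l ->.
  by [].
left; apply/andP; split.
  by rewrite all_map; apply/allP => i _; rewrite /light /=; lia.
by rewrite /mass big_map sum1_size size_iota.
Qed.
End Game.

(** * Colorings and blocks of vertices *)

Section Blocks.
Variable T : eqType.
Implicit Types (s : seq (seq T)) (b : seq T).

(** A queried edge either lies inside one block, so that its answer is already
    determined, or joins two consecutive blocks. *)
Lemma flatten_adjacent s l1 u v l2 : [::] \notin s -> flatten s = l1 ++ u :: v :: l2 ->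
  (exists b, [/\ b \in s, u \in b & v \in b]) \/
  (exists s1 b1 b2 s2, [/\ s = s1 ++ b1 :: b2 :: s2, u \in b1 & v \in b2]).
Proof.
elim: s l1 => [|b s IH] l1; first by case: l1.
rewrite inE negb_or => /andP[_ sn0] /= E.
have [bl1|l1b] := leqP (size b) (size l1).
  have tb : take (size b) l1 = b.
    by rewrite -[RHS](take_size_cat (flatten s) (erefl (size b))) E takel_cat.
  move/eqP: E; rewrite -(cat_take_drop (size b) l1) tb -catA eqseq_cat // eqxx /=.
  move/eqP/(IH _ sn0); case=> [[b' [b's ub vb]]|[s1 [b1 [b2 [s2 [-> ub vb]]]]]].
    by left; exists b'; rewrite inE b's orbT.
  by right; exists (b :: s1), b1, b2, s2.
have tb : take (size l1) b = l1.
  by rewrite -[RHS](take_size_cat [:: u, v & l2] (erefl (size l1))) -E takel_cat // ltnW.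
move/eqP: E; rewrite -{1}(cat_take_drop (size l1) b) tb -catA eqseq_cat // eqxx /=.
move/eqP.
have sub x : x \in drop (size l1) b -> x \in b by apply: mem_drop.
case: (drop _ _) (size_drop (size l1) b) sub => [|x d] sz sub /=; first by move: sz => /=; lia.
case=> ?; subst x; case: d sub {sz} => [|y d] sub /=; last first.
  by case=> ? _; subst y; left; exists b; rewrite mem_head !sub // !inE eqxx ?orbT.
case: s sn0 {IH} => [|[|y b2] s] //= sn0 [-> _].
by right; exists [::], b, (v :: b2), s; rewrite sub !inE eqxx.
Qed.

Lemma uniq_flatten_mid s1 b s2 b' x : uniq (flatten (s1 ++ b :: s2)) ->
  b' \in s1 ++ s2 -> x \in b' -> x \in b -> False.
Proof.
rewrite flatten_cat /= uniq_catCA cat_uniq -flatten_cat => /and3P[_ /hasPn h _] b's xb' xb.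
have /h : x \in flatten (s1 ++ s2) by apply/flattenP; exists b'.
by rewrite /= xb.
Qed.

Definition block_of s x := nth [::] s (find (fun b => x \in b) s).

Lemma block_ofE s b x : uniq (flatten s) -> b \in s -> x \in b -> block_of s x = b.
Proof.
rewrite /block_of; elim: s => //= b' s IH; rewrite cat_uniq => /and3P[_ /hasPn h us].
rewrite inE => /predU1P[-> ->//|bs xb]; case: ifP => [xb'|_]; last exact: IH.
have /h : x \in flatten s by apply/flattenP; exists b.
by rewrite /= xb'.
Qed.
End Blocks.

Section Colorings.
Variable T : finType.
Implicit Types (c : coloring T) (s : seq (seq T)) (b : seq T).
Local Open Scope ring_scope.

Definition color_sum c b : int := \sum_(i <- b) (if c i then 1 else -1).

(** The colorings with the same answers as [c] on all edges inside the blocks of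
    [s]. *)
Definition compatible c s c' := forall b, b \in s -> 
  {in b &, forall i j, (c' i == c' j) = (c i == c j)}.

Definition recolor (flip : bool) b c : coloring T :=
  [ffun i => c i (+) (flip && (i \in b))].

Lemma color_sum_flip c c' b (f : bool) : {in b, forall i, c' i = c i (+) f} ->
  color_sum c' b = if f then - color_sum c b else color_sum c b.
Proof.
move=> cc'; rewrite /color_sum; case: f cc' => cc'; last first.
  by apply: eq_big_seq => i /cc' ->; rewrite addbF.
by rewrite -sumrN; apply: eq_big_seq => i /cc' ->; rewrite addbT; case: (c i).
Qed.

Lemma color_sum_cat c b1 b2 : color_sum c (b1 ++ b2) = color_sum c b1 + color_sum c b2.
Proof. exact: big_cat. Qed.

(** The color classes of different blocks can be exchanged independently. *)
Lemma flip_blocks c s (f : seq T -> bool) : uniq (flatten s) ->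
  exists2 c', compatible c s c' & {in s, forall b, {in b, forall i, c' i = c i (+) f b}}.
Proof.
move=> us; pose c' : coloring T := [ffun i => c i (+) f (block_of s i)].
have cE b i : b \in s -> i \in b -> c' i = c i (+) f b.
  by move=> bs ib; rewrite ffunE (block_ofE us bs ib).
exists c' => [b bs i j ib jb|b bs i ib]; last exact: cE.
by rewrite !(cE b) //; case: (c i) (c j) (f b) => [] [] [].
Qed.

Lemma majority_vertex_sum c v :
  majority_vertex c v = if c v then 0 < color_sum c (enum T) else color_sum c (enum T) < 0.
Proof.
have E : (2 * #|[set u | c u == c v]|)%:Z =
    \sum_u (if c u == c v then 1 else -1) + #|T|%:Z.
  rewrite -sum1dep_card big_mkcond /= -[#|T|]sum1_card big_mkcond /= !PoszM.
  rewrite -!natz !natr_sum mulr_sumr -big_split /=.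
  by apply: eq_bigr => u _; case: (c u == c v).
rewrite /majority_vertex -ltz_nat E ltrDr /color_sum -big_enum /=.
case: (c v); first by under eq_bigr do rewrite eqb_id.
rewrite -oppr_gt0 -sumrN; congr (_ < _); apply: eq_bigr => u _.
by case: (c u).
Qed.
End Colorings.

(** * The adversary on a path *)

Section Path.
Variable n : nat.
Implicit Types (c : coloring 'I_n) (s : seq (seq 'I_n)) (b : seq 'I_n).

Lemma recolor_other f b c b' i : i \in b' -> (forall x, x \in b' -> x \in b -> False) ->
  recolor f b c i = c i.
Proof.
move=> ib' dis; rewrite ffunE.
by case: (boolP (i \in b)) => [/(dis _ ib')|_]; rewrite ?andbF ?addbF.
Qed.

Lemma recolor_in f b c i : i \in b -> recolor f b c i = c i (+) f.
Proof. by move=> ib; rewrite ffunE ib andbT. Qed.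

(** Flipping a whole block and merging it with its neighbor only adds
    constraints. *)
Lemma compatible_merge f c s1 b1 b2 s2 c' : uniq (flatten (s1 ++ b1 :: b2 :: s2)) ->
  compatible (recolor f b2 c) (s1 ++ (b1 ++ b2) :: s2) c' ->
  compatible c (s1 ++ b1 :: b2 :: s2) c'.
Proof.
move=> us cc' b bs i j ib jb.
have merged : b1 ++ b2 \in s1 ++ (b1 ++ b2) :: s2 by rewrite mem_cat mem_head orbT.
have [eb|nb] := eqVneq b b2.
  rewrite (cc' _ merged) ?mem_cat -?eb ?ib ?jb ?orbT // !recolor_in //.
  by case: (c i) (c j) (f) => [] [] [].
have bs' : b \in rcons s1 b1 ++ s2.
  move: bs; rewrite !mem_cat mem_rcons !inE (negbTE nb) /=.
  by case/or3P => ->; rewrite ?orbT.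
have dis x : x \in b -> x \in b2 -> False.
  by apply: (uniq_flatten_mid _ bs'); rewrite cat_rcons.
rewrite -!(@recolor_other f b2 c b) //.
have [eb|nb1] := eqVneq b b1; first by apply: (cc' _ merged); rewrite mem_cat -eb ?ib ?jb.
apply: cc' ib jb; move: bs'; rewrite !mem_cat mem_rcons !inE (negbTE nb1) /=.
by case/orP => ->; rewrite ?orbT.
Qed.

Lemma path_edge_adjacent (u v : 'I_n) : edge (path_graph n) u v ->
  exists l1 l2, enum 'I_n = l1 ++ u :: v :: l2 \/ enum 'I_n = l1 ++ v :: u :: l2.
Proof.
have adj (x y : 'I_n) : x.+1 = y -> exists l1 l2, enum 'I_n = l1 ++ x :: y :: l2.
  move=> xy; exists (take x (enum 'I_n)), (drop x.+2 (enum 'I_n)).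
  rewrite -[LHS](cat_take_drop x); congr (_ ++ _).
  have sz := size_enum_ord n.
  rewrite (drop_nth x) ?sz // (drop_nth x) ?sz ?xy //.
  by congr [:: _, _ & _]; rewrite ?xy; apply: val_inj; rewrite /= nth_enum_ord.
case/orP => /eqP /adj [l1 [l2 E]]; exists l1, l2; by [left|right].
Qed.

(** Every answer between two blocks merges them, so on the branch followed by the
    adversary the number of blocks drops by at most one per query. The adversary
    answers by flipping the reference coloring on [b2], or not, before merging;
    the branch is whichever the reference coloring then dictates. *)
Lemma adversary (good : coloring 'I_n -> seq (seq 'I_n) -> Prop) L :
  (forall c s, good c s -> flatten s = enum 'I_n /\ [::] \notin s) ->
  (forall c s1 b1 b2 s2, good c (s1 ++ b1 :: b2 :: s2) ->
     exists f, good (recolor f b2 c) (s1 ++ (b1 ++ b2) :: s2)) ->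
  (forall c s o, good c s ->
     (forall c', compatible c s c' -> correct_output c' o) -> size s <= L) ->
  forall (A : algorithm (path_graph n)) c s, queries_edges A -> good c s ->
    (forall c', compatible c s c' -> correct_output c' (output A c')) ->
  exists2 c', compatible c s c' & size s <= num_queries A c' + L.
Proof.
move=> good_split good_merge good_final; elim=> [o|u v As IHs Ad IHd] c s qe gs sol /=.
  by exists c => //; apply: good_final gs sol.
case/and3P: qe => uv qs qd; have [fs sn0] := good_split _ _ gs.
have inside c1 s1 b : good c1 s1 -> b \in s1 -> u \in b -> v \in b ->
    (forall c', compatible c1 s1 c' -> compatible c s c') ->
    exists2 c', compatible c1 s1 c' &
      size s1 <= (if c' u == c' v then num_queries As c' else num_queries Ad c') + L.
  move=> gs1 bs ub vb sub.
  have agree c' : compatible c1 s1 c' -> (c' u == c' v) = (c1 u == c1 v).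
    by move=> cc'; apply: cc' ub vb.
  have [e|ne] := boolP (c1 u == c1 v).
    have [] := IHs c1 s1 qs gs1.
      by move=> c' cc'; have := sol c' (sub c' cc'); rewrite /= (agree c') // e.
    by move=> c' cc' le; exists c'; rewrite ?(agree c') ?e.
  have [] := IHd c1 s1 qd gs1.
    by move=> c' cc'; have := sol c' (sub c' cc'); rewrite /= (agree c') // (negbTE ne).
  by move=> c' cc' le; exists c'; rewrite ?(agree c') ?(negbTE ne).
have us : uniq (flatten s) by rewrite fs enum_uniq.
have between s1 b1 b2 s2 : s = s1 ++ b1 :: b2 :: s2 -> u \in b1 ++ b2 -> v \in b1 ++ b2 ->
    exists2 c', compatible c s c' & 
      size s <= (if c' u == c' v then num_queries As c' else num_queries Ad c').+1 + L.
  move=> Es ub vb; have gs' := gs; rewrite Es in gs'.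
  have [f gm] := good_merge _ _ _ _ _ gs'.
  have sub c' : compatible (recolor f b2 c) (s1 ++ (b1 ++ b2) :: s2) c' -> compatible c s c'.
    by rewrite Es; apply: compatible_merge; rewrite -Es.
  have [] := inside _ _ (b1 ++ b2) gm _ ub vb sub; first by rewrite mem_cat mem_head orbT.
  move=> c' cc' le; exists c'; first exact: sub.
  by move: le; rewrite Es !size_cat /= addSn !addnS ltnS.
have in_block b : b \in s -> u \in b -> v \in b -> exists2 c', compatible c s c' & 
      size s <= (if c' u == c' v then num_queries As c' else num_queries Ad c').+1 + L.
  move=> bs ub vb; have [//|c' cc' le] := inside c s b gs bs ub vb.
  by exists c' => //; rewrite addSn; apply: leq_trans le _.
have [l1 [l2 []]] := path_edge_adjacent uv; rewrite -fs => /(flatten_adjacent sn0).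
  case=> [[b [bs ub vb]]|[s1 [b1 [b2 [s2 [Es ub vb]]]]]]; first exact: in_block bs ub vb.
  by apply: between Es _ _; rewrite mem_cat ?ub ?vb ?orbT.
case=> [[b [bs ub vb]]|[s1 [b1 [b2 [s2 [Es ub vb]]]]]]; first exact: in_block bs vb ub.
by apply: between Es _ _; rewrite mem_cat ?ub ?vb ?orbT.
Qed.

Variable k : nat.
Let o := odd n.
Hypothesis nQ : 2 * 2 ^ k + o <= n.
Hypothesis Qn : n + 2 <= 4 * 2 ^ k + o.

Definition component_of c b : component :=
  ([seq val i %% 6 == (n %% 6 == 5) | i <- b], color_sum c b).

Definition safe_position c s := flatten s = enum 'I_n /\ safe n k [seq component_of c b | b <- s].

Lemma safe_position_partition c s : safe_position c s -> flatten s = enum 'I_n /\ [::] \notin s.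
Proof.
case=> fs [[_ /allP snd] _]; split=> //; apply/negP => s0.
by have /and4P[] := snd _ (map_f (component_of c) s0).
Qed.

Lemma safe_position_step c s1 b1 b2 s2 : safe_position c (s1 ++ b1 :: b2 :: s2) ->
  exists f, safe_position (recolor f b2 c) (s1 ++ (b1 ++ b2) :: s2).
Proof.
case=> fs; rewrite map_cat /= => /(safe_step nQ Qn) [b sm].
have us : uniq (flatten (rcons s1 b1 ++ b2 :: s2)) by rewrite cat_rcons fs enum_uniq.
exists (~~ b); split; first by rewrite -fs !flatten_cat /= !catA.
have other b' : b' \in rcons s1 b1 ++ s2 ->
    color_sum (recolor (~~ b) b2 c) b' = color_sum c b'.
  move=> bs'; apply: (@color_sum_flip _ _ _ _ false) => i ib'; rewrite addbF.
  exact: recolor_other ib' (fun x => uniq_flatten_mid us bs').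
rewrite map_cat /=.
have same s' : {subset s' <= rcons s1 b1 ++ s2} ->
    [seq component_of (recolor (~~ b) b2 c) b' | b' <- s'] = [seq component_of c b' | b' <- s'].
  by move=> sub; apply/eq_in_map => b' /sub /other; rewrite /component_of => ->.
rewrite !same; last 2 first.
- by move=> x xs; rewrite mem_cat xs orbT.
- by move=> x xs; rewrite mem_cat mem_rcons inE xs orbT.
suff -> : component_of (recolor (~~ b) b2 c) (b1 ++ b2) =
    join b (component_of c b1) (component_of c b2) by [].
rewrite /component_of /join /= map_cat color_sum_cat other; last first.
  by rewrite mem_cat mem_rcons mem_head.
rewrite (color_sum_flip (fun i => @recolor_in (~~ b) b2 c i)).
by case: b {sm other same}.
Qed.

Lemma mass_components c s :
  mass [seq component_of c b | b <- s] = (\sum_(b <- s) absz (color_sum c b))%N.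
Proof. by rewrite /mass big_map. Qed.

Lemma color_sum_flatten c s : (color_sum c (flatten s) = \sum_(b <- s) color_sum c b)%R.
Proof. by rewrite /color_sum big_flatten. Qed.

(** Blocks flipped against their own majority contribute minus their weights. *)
Lemma sum_opposed c c' (f : seq 'I_n -> bool) s :
  {in s, forall b, f b = (0 < color_sum c b)%R} ->
  {in s, forall b, {in b, forall i, c' i = c i (+) f b}} ->
  (\sum_(b <- s) color_sum c' b = - (mass [seq component_of c b | b <- s])%:Z)%R.
Proof.
move=> fE cc'; rewrite mass_components (big_morph Posz PoszD (erefl _)) -sumrN.
apply: eq_big_seq => b bs; rewrite (color_sum_flip (cc' b bs)) fE //.
by case: ifP => h; [rewrite gtz0_abs|rewrite lez0_abs ?opprK // leNgt h].
Qed.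

(** An output [v] must survive when its block gets the color of [v] and all the
    other blocks are turned against that color, which forces domination. The
    output [None] must survive when all blocks are turned against red, which
    forces all weights to be zero. *)
Lemma safe_position_stop c s out : safe_position c s ->
  (forall c', compatible c s c' -> correct_output c' out) -> size s <= 5.
Proof.
case=> fs sf sol; rewrite -(size_map (component_of c)).
have us : uniq (flatten s) by rewrite fs enum_uniq.
apply: (safe_decided nQ Qn sf); case: out sol => [v|] sol; last first.
  left; apply/negPn/negP => nz.
  have [c' cc' sgn] := flip_blocks c (fun b => 0 < color_sum c b)%R us.
  have tot : (color_sum c' (enum 'I_n) < 0)%R.
    rewrite -fs color_sum_flatten (sum_opposed _ sgn) // oppr_lt0 ltz_nat lt0n.
    apply: contra nz => /eqP m0; rewrite all_map; apply/allP => b bs /=.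
    move/eqP: m0; rewrite mass_components sum_nat_seq_eq0 => /allP /(_ b bs).
    by rewrite absz_eq0.
  have [v /negbTE cv] : exists v, ~~ c' v.
    apply/existsP; rewrite -negb_forall; apply: contraL tot => /forallP all1.
    rewrite -leNgt; apply: sumr_ge0 => i _; by rewrite all1.
  have /forallP /(_ v) := sol c' cc'.
  by rewrite (@majority_vertex_sum 'I_n) cv tot.
right.
have /flattenP [b bs vb] : v \in flatten s by rewrite fs mem_enum.
case/splitPr: bs fs sf us sol => s1 s2 fs sf us sol.
pose f b' := if v \in b' then ~~ c v else (0 < color_sum c b')%R.
have [c' cc' sgn] := flip_blocks c f us.
exists [seq component_of c b' | b' <- s1], (component_of c b), [seq component_of c b' | b' <- s2].
rewrite map_cat; split=> //; rewrite -map_cat.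
have cv : c' v = true.
  by rewrite (sgn b) ?mem_cat ?mem_head ?orbT // /f vb; case: (c v).
have rest : (\sum_(b' <- s1 ++ s2) color_sum c' b' =
    - (mass [seq component_of c b' | b' <- s1 ++ s2])%:Z)%R.
  apply: (@sum_opposed c c' f) => b' bs'.
    rewrite /f; case: ifP => // vb'; case: (uniq_flatten_mid us bs' vb' vb).
  by apply: sgn; move: bs'; rewrite !mem_cat inE => /orP[->|->]; rewrite ?orbT.
have := sol c' cc'; rewrite /= (@majority_vertex_sum 'I_n) cv -fs color_sum_flatten.
rewrite big_cat big_cons /= addrCA -big_cat rest.
have := color_sum_flip (sgn b _); rewrite mem_cat mem_head orbT => /(_ isT) ->.
by rewrite /=; move: (color_sum c b) (mass _) => x M; case: (f b); lia.
Qed.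

Lemma safe_position_start : safe_position [ffun=> true] [seq [:: i] | i <- enum 'I_n].
Proof.
split; first by elim: (enum _) => //= i l ->.
suff -> : [seq component_of [ffun=> true] b | b <- [seq [:: i] | i <- enum 'I_n]] =
    [seq ([:: i %% 6 == (n %% 6 == 5)], 1%R) | i <- iota 0 n] by exact: safe_start.
rewrite -val_enum_ord -!map_comp; apply: eq_map => i.
by rewrite /= /component_of /color_sum big_seq1 ffunE.
Qed.

Lemma path_lower_bound_window : n - 5 <= m (path_graph n).
Proof.
have [[A [qA solA] wA] _] := mP (@path_graph_connected n).
have [|c _] := adversary safe_position_partition safe_position_step safe_position_stop
  qA safe_position_start.
  by move=> c' _; apply: solA.
rewrite size_map size_enum_ord => le; rewrite leq_subLR addnC.
apply: leq_trans le _; rewrite leq_add2r; apply: leq_trans wA.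
exact: (leq_bigmax (F := num_queries A)).
Qed.
End Path.

(** The even number [n - odd n] lies between [2 ^ k.+1] and [2 ^ k.+2 - 2] for some
    [k]. *)
Lemma path_lower_bound n : n - 5 <= m (path_graph n).
Proof.
have [n5|n5] := leqP n 5; first by rewrite (eqP n5).
pose t := trunc_log 2 (n - odd n).
have /andP[lo hi] : 2 ^ t <= n - odd n < 2 ^ t.+1 by apply: trunc_log_bounds => //; lia.
case: t lo hi => [|t] lo hi; first by move: hi; rewrite expn1; lia.
by apply: (@path_lower_bound_window n t); move: lo hi; rewrite !expnS; lia.
Qed.

Theorem theorem3p4 (n : nat) :
  n - 6 <= m (path_graph n) /\
  (~ ((exists k, n + 1 = 2 ^ k) \/ (exists k, n + 3 = 2 ^ k)) ->
   n - 5 <= m (path_graph n)).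
Proof.
have bound := path_lower_bound n; split=> //.
by apply: leq_trans bound; rewrite leq_sub2l.
Qed.
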